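(* Let $G$ be a finitely generated group in the variety $\mathcal U\mathcal N\mathcal N$, i.e. $G$ has a normal abelian subgroup $A$ such that $G/A$ has a normal nilpotent subgroup with nilpotent quotient. Then for every finite generating set $X$ of $G$, $\mathrm{pw}(G,X)<\infty$.
   Context: $\mathcal U$ denotes the variety of abelian groups and $\mathcal N$ the class of nilpotent groups; $\mathcal U\mathcal N\mathcal N$ is the class of abelian-by-nilpotent-by-nilpotent groups as described. For a group $G$ generated by a set $X$, a palindrome is an element of $G$ represented by a reduced word in $X^{\pm1}$ that reads the same forwards and backwards; $l_{\mathcal P}(g)$ is the minimal number of palindromes whose product is $g$, and $\mathrm{pw}(G,X)=\sup_{g\in G} l_{\mathcal P}(g)$. *)

(* Defs.v *)
From Stdlib Require Import List Arith.
Import ListNotations.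

Record group := Group {
  carrier :> Type;
  gmul : carrier -> carrier -> carrier;
  ginv : carrier -> carrier;
  gone : carrier;
  gmulA : forall x y z, gmul x (gmul y z) = gmul (gmul x y) z;
  gmul1g : forall x, gmul gone x = x;
  gmulVg : forall x, gmul (ginv x) x = gone
}.

Section GroupDefs.
Variable G : group.

Inductive gen (P : G -> Prop) : G -> Prop :=
| gen_base : forall x, P x -> gen P x
| gen_one : gen P (gone G)
| gen_mul : forall x y, gen P x -> gen P y -> gen P (gmul G x y)
| gen_inv : forall x, gen P x -> gen P (ginv G x).

Definition is_subgroup (H : G -> Prop) : Prop :=
  H (gone G) /\ (forall x y, H x -> H y -> H (gmul G x y)) /\
  (forall x, H x -> H (ginv G x)).

Definition is_normal (H : G -> Prop) : Prop :=
  is_subgroup H /\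
  forall x g, H x -> H (gmul G (ginv G g) (gmul G x g)).

Definition is_abelian (H : G -> Prop) : Prop :=
  forall x y, H x -> H y -> gmul G x y = gmul G y x.

Definition comm (a b : G) : G :=
  gmul G (ginv G a) (gmul G (ginv G b) (gmul G a b)).

(* lower central series of H: lcs H 0 = H = gamma_1(H),
   lcs H (S i) = [lcs H i, H] = gamma_{i+2}(H) *)
Fixpoint lcs (H : G -> Prop) (i : nat) : G -> Prop :=
  match i with
  | 0 => H
  | S i' => gen (fun z => exists a b, lcs H i' a /\ H b /\ z = comm a b)
  end.

(* For K <= H, both normal in G: H/K is nilpotent, i.e. gamma_{c+1}(H) <= K *)
Definition nilpotent_mod (H K : G -> Prop) : Prop :=
  exists c, forall g, lcs H c g -> K g.

(* G in the variety UNN: a normal abelian A, and a normal N >= A with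
   N/A nilpotent and G/N nilpotent (correspondence theorem form of
   "G/A has a normal nilpotent subgroup with nilpotent quotient"). *)
Definition in_UNN : Prop :=
  exists A N : G -> Prop,
    is_normal A /\ is_normal N /\ (forall a, A a -> N a) /\
    is_abelian A /\ nilpotent_mod N A /\ nilpotent_mod (fun _ => True) N.

Definition letter_val (l : G * bool) : G :=
  if snd l then fst l else ginv G (fst l).

Definition word_val (w : list (G * bool)) : G :=
  fold_right (fun l acc => gmul G (letter_val l) acc) (gone G) w.

Definition word_over (X : list G) (w : list (G * bool)) : Prop :=
  Forall (fun l => In (fst l) X) w.

Fixpoint reduced (w : list (G * bool)) : Prop :=
  match w with
  | a :: ((b :: _) as t) => ~ (fst a = fst b /\ snd a <> snd b) /\ reduced t
  | _ => True
  end.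

Definition palindrome (X : list G) (g : G) : Prop :=
  exists w, word_over X w /\ reduced w /\ rev w = w /\ word_val w = g.

Definition generates (X : list G) : Prop :=
  forall g : G, gen (fun x => In x X) g.

Definition gprod (s : list G) : G := fold_right (gmul G) (gone G) s.

Definition pal_len_le (X : list G) (g : G) (n : nat) : Prop :=
  exists ps : list G, length ps <= n /\ Forall (palindrome X) ps /\ gprod ps = g.

Definition pw_finite (X : list G) : Prop :=
  exists n, forall g : G, pal_len_le X g n.

End GroupDefs.

(* Main.v *)
(** Writing [g'] for the reversal of a word [g], a conjugate of a palindrome
    [p] is [g p g^-1 = (g p g') (g'^-1 g^-1)], a product of two palindromes.
    Hence, for fixed [b], all commutators [[a, b]] have bounded palindromic
    length.

    Let [N] be the first term of the lower central series of [G] with nilpotent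
    quotient inside the given subgroup; it is the normal closure of finitely
    many simple commutators [b_j]. Let [N_i] be the lower central series of [N],
    so that some [N_c] is abelian. The chain
    [G > [G,G] > ... > N > [N,G] > N_1 > [N_1,G] > N_2 > ... > [N_c,G] > 1]
    has factors of bounded palindromic width: [G/[G,G]] is a product of cyclic
    groups generated by [X]; [[N_i,G]] is, modulo [N_{i+1}] (modulo [1] for
    [i = c]), the product of the images of the homomorphisms [a |-> [a, x]],
    [x] in [X]; and [N_{i+1}] is central modulo [[N_{i+1},G]], so
    [[a, b^g] = [a^(g^-1), b]] there and it is the product of the images of the
    finitely many homomorphisms [a |-> [a, b_j]] on [N_i]. *)

Require Import Defs.
From Stdlib Require Import List Lia Classical Setoid Morphisms.
Import ListNotations.

Declare Scope group_scope.
Notation "x * y" := (gmul _ x y) : group_scope.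
Notation "x ^-1" := (ginv _ x)
  (at level 3, left associativity, format "x ^-1") : group_scope.
Notation "1" := (gone _) : group_scope.
Open Scope group_scope.

Arguments comm {G}.
Arguments gen {G}.
Arguments lcs {G}.
Arguments is_normal {G}.
Arguments is_subgroup {G}.
Arguments palindrome {G}.
Arguments pal_len_le {G}.
Arguments word_val {G}.
Arguments letter_val {G}.
Arguments word_over {G}.
Arguments reduced {G}.
Arguments gprod {G}.

(** * Group identities *)

Section Identities.
Variable G : group.
Implicit Types x y z : G.

Lemma mulKV x y : x^-1 * (x * y) = y.
Proof. now rewrite gmulA, gmulVg, gmul1g. Qed.

Lemma mul_cancel x y z : x * y = x * z -> y = z.
Proof. intros E; rewrite <- (mulKV x y), E; apply mulKV. Qed.

Lemma mulgV x : x * x^-1 = 1.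
Proof.
  apply (mul_cancel x^-1); rewrite mulKV.
  apply (mul_cancel (x^-1)^-1); rewrite !mulKV.
  now rewrite gmulVg.
Qed.

Lemma mulg1 x : x * 1 = x.
Proof. now rewrite <- (gmulVg _ x), gmulA, mulgV, gmul1g. Qed.

Lemma mulgK x y : y * x * x^-1 = y.
Proof. now rewrite <- gmulA, mulgV, mulg1. Qed.

Lemma mulgKV x y : y * x^-1 * x = y.
Proof. now rewrite <- gmulA, gmulVg, mulg1. Qed.

Lemma invK x : (x^-1)^-1 = x.
Proof. apply (mul_cancel x^-1); now rewrite mulgV, gmulVg. Qed.

Lemma inv1 : (1 : G)^-1 = 1.
Proof. now rewrite <- (mulg1 (1^-1)), gmulVg. Qed.

Lemma invM x y : (x * y)^-1 = y^-1 * x^-1.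
Proof.
  apply (mul_cancel (x * y)).
  now rewrite mulgV, !gmulA, mulgK, mulgV.
Qed.

End Identities.

#[global] Hint Rewrite gmulA gmul1g gmulVg mulgV mulg1 mulgK mulgKV invK inv1 invM
  : group.

(* The rewriting system is complete for free groups. *)
Ltac group := unfold comm; autorewrite with group; reflexivity.

(** * Palindromes *)

Section Palindromes.
Variable G : group.
Variable X : list G.
Implicit Types (l m : G * bool) (w : list (G * bool)) (g p : G).

Definition opposite l m : Prop := fst l = fst m /\ snd l <> snd m.

Definition flip l : G * bool := (fst l, negb (snd l)).

Lemma letter_val_opposite l m : opposite l m -> letter_val m = (letter_val l)^-1.
Proof.
  destruct l as [x b], m as [y c]; unfold opposite, letter_val; simpl.
  intros [-> ne]; destruct b, c; try congruence; group.
Qed.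

Lemma letter_val_flip l : letter_val (flip l) = (letter_val l)^-1.
Proof. apply letter_val_opposite; destruct l as [x []]; split; simpl; congruence. Qed.

Lemma word_val_app w1 w2 : word_val (w1 ++ w2) = word_val w1 * word_val w2.
Proof.
  induction w1 as [|l w1 IH]; simpl; [group|].
  now rewrite IH, gmulA.
Qed.

Lemma word_val_flip w : word_val (rev (map flip w)) = (word_val w)^-1.
Proof.
  induction w as [|l w IH]; simpl; [group|].
  rewrite word_val_app, IH; simpl; rewrite letter_val_flip; group.
Qed.

Lemma reduced_flip w : reduced w -> reduced (map flip w).
Proof.
  induction w as [|l [|m w] IH]; simpl; auto.
  intros [no red]; split; [|now apply IH].
  destruct l as [x b], m as [y c]; simpl in *.
  intros [-> ne]; apply no; split; [easy|].
  now destruct b, c.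
Qed.

Lemma palindrome_inv p : palindrome X p -> palindrome X p^-1.
Proof.
  intros (w & over & red & pal & <-); exists (map flip w).
  repeat split.
  - apply Forall_map; revert over; apply Forall_impl; auto.
  - now apply reduced_flip.
  - now rewrite <- map_rev, pal.
  - rewrite <- word_val_flip, <- map_rev, pal; reflexivity.
Qed.

Lemma palindrome_one : palindrome X (1 : G).
Proof. exists []; repeat split; constructor. Qed.

Lemma palindrome_gen x : In x X -> palindrome X x.
Proof.
  intros Xx; exists [(x, true)]; repeat split; [now repeat constructor|].
  unfold word_val, letter_val; simpl; group.
Qed.

Lemma reduced_snoc w m l :
  reduced (w ++ [m]) -> ~ opposite m l -> reduced (w ++ [m; l]).
Proof.
  unfold opposite; intros red nopp; induction w as [|a [|b w] IH]; simpl in *.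
  - tauto.
  - tauto.
  - destruct red as [no red]; exact (conj no (IH red)).
Qed.

Lemma reduced_prefix w1 w2 : reduced (w1 ++ w2) -> reduced w1.
Proof.
  induction w1 as [|a [|b w] IH]; simpl in *; try easy.
  intros [no red]; exact (conj no (IH red)).
Qed.

(** If [l] cancels the first letter of [w], by symmetry it cancels the last one too, and removing
    both leaves a palindrome; otherwise the longer word is still reduced. *)
Lemma palindrome_wrap_letter l p :
  In (fst l) X -> palindrome X p -> palindrome X (letter_val l * p * letter_val l).
Proof.
  intros Xl (w & over & red & pal & <-).
  destruct w as [|m t].
  { exists [l; l]; repeat split; [now repeat constructor|tauto|].
    simpl; group. }
  destruct (classic (opposite l m)) as [opp|nopp].
  - destruct t as [|m' q _] using rev_ind.
    (* A one-letter word offers a single letter to cancel: with [m] opposite to [l], the product of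
       [l], [m], [l] is [l]. *)
    + exists [l]; repeat split; [now repeat constructor|].
      simpl; rewrite (letter_val_opposite l m opp); group.
    + simpl in pal; rewrite rev_app_distr in pal; simpl in pal.
      injection pal as -> pal; apply app_inj_tail in pal; destruct pal as [pal _].
      exists q; repeat split; auto.
      * inversion over as [|? ? _ over']; apply Forall_app in over'; tauto.
      * apply reduced_prefix with (w2 := [m]).
        destruct (q ++ [m]); simpl in red; tauto.
      * simpl; rewrite word_val_app; simpl.
        rewrite (letter_val_opposite l m opp); group.
  - exists (l :: (m :: t) ++ [l]); refine (conj _ (conj _ (conj _ _))).
    + constructor; auto; apply Forall_app; split; auto.
    + split; [exact nopp|].
      change (m :: t ++ [l]) with ((m :: t) ++ [l]).
      (* Replacing the word by its reversal exposes [m] as its last letter. *)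
      rewrite <- pal in red |- *; cbn [rev] in *; rewrite <- app_assoc; cbn [app].
      apply reduced_snoc; auto.
      intros [e ne]; apply nopp; split; auto.
    + cbn [rev]; rewrite rev_app_distr; cbn [rev app] in *; now rewrite pal.
    + simpl; rewrite word_val_app; simpl; group.
Qed.

Lemma palindrome_wrap x p : In x X -> palindrome X p -> palindrome X (x * p * x).
Proof. exact (palindrome_wrap_letter (x, true) p). Qed.

Lemma palindrome_wrapV x p :
  In x X -> palindrome X p -> palindrome X (x^-1 * p * x^-1).
Proof. exact (palindrome_wrap_letter (x, false) p). Qed.

Fixpoint pow (x : G) n : G := match n with 0 => 1 | S n => x * pow x n end.

Lemma pow_add x i j : pow x (i + j) = pow x i * pow x j.
Proof. induction i as [|i IH]; simpl; [|rewrite IH]; group. Qed.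

Lemma palindrome_pow x n : In x X -> palindrome X (pow x n).
Proof.
  (* Wrapping raises the exponent by two, so the induction carries two consecutive exponents. *)
  intros Xx; enough (palindrome X (pow x n) /\ palindrome X (pow x (S n))) by tauto.
  induction n as [|n [IH IH']].
  - split; [apply palindrome_one|]; simpl; rewrite mulg1; now apply palindrome_gen.
  - split; auto.
    replace (pow x (S (S n))) with (x * pow x n * x); [now apply palindrome_wrap|].
    replace (S (S n)) with (1 + n + 1) by lia; rewrite !pow_add; simpl; group.
Qed.

(* [g'] plays the role of the reversal of [g], which depends on a word for [g]. *)
Lemma exists_mirror g : gen (fun x => In x X) g ->
  exists g', forall p, palindrome X p ->
    palindrome X (g * p * g') /\ palindrome X (g^-1 * p * g'^-1).
Proof.
  induction 1 as [x Xx| |g h _ (g' & IHg) _ (h' & IHh)|g _ (g' & IHg)].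
  - exists x; split; [now apply palindrome_wrap|now apply palindrome_wrapV].
  - exists 1; intros p pal; autorewrite with group; auto.
  - exists (h' * g'); intros p pal; split.
    + replace (g * h * p * (h' * g')) with (g * (h * p * h') * g') by group.
      now apply IHg, IHh.
    + replace ((g * h)^-1 * p * (h' * g')^-1)
        with (h^-1 * (g^-1 * p * g'^-1) * h'^-1) by group.
      now apply IHh, IHg.
  - exists g'^-1; intros p pal; rewrite !invK; split; now apply IHg.
Qed.

(** * Palindromic length of products, conjugates and commutators *)

Hypothesis genX : generates G X.

Lemma pal_len_mul g h n k :
  pal_len_le X g n -> pal_len_le X h k -> pal_len_le X (g * h) (n + k).
Proof.
  intros (ps & len & pal & <-) (qs & len' & pal' & <-); exists (ps ++ qs).
  repeat split.
  - rewrite length_app; lia.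
  - now apply Forall_app.
  - clear; induction ps as [|p ps IH]; simpl; [|rewrite IH]; group.
Qed.

Lemma pal_len_one : pal_len_le X 1 0.
Proof. exists []; repeat split; auto. Qed.

Lemma pal_len_palindrome p : palindrome X p -> pal_len_le X p 1.
Proof. intros pal; exists [p]; repeat split; auto; simpl; group. Qed.

Lemma pal_len_inv g n : pal_len_le X g n -> pal_len_le X g^-1 n.
Proof.
  intros (ps & len & pal & <-); exists (rev (map (ginv G) ps)); repeat split.
  - now rewrite length_rev, length_map.
  - apply Forall_rev, Forall_map; revert pal; apply Forall_impl, palindrome_inv.
  - clear; induction ps as [|p ps IH]; simpl; [group|].
    rewrite invM, <- IH; generalize (rev (map (ginv G) ps)); clear.
    intros s; induction s as [|q s IH]; simpl; [|rewrite IH]; group.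
Qed.

Lemma pal_len_conj_palindrome g p : palindrome X p -> pal_len_le X (g * p * g^-1) 2.
Proof.
  intros pal; destruct (exists_mirror g (genX g)) as (g' & mir).
  replace (g * p * g^-1) with ((g * p * g') * (g * 1 * g')^-1) by group.
  apply (pal_len_mul _ _ 1 1); apply pal_len_palindrome.
  - now apply mir.
  - apply palindrome_inv, mir, palindrome_one.
Qed.

Lemma pal_len_conj g h n : pal_len_le X h n -> pal_len_le X (g * h * g^-1) (n + n).
Proof.
  intros (ps & len & pal & <-); revert n len.
  induction pal as [|p ps pal _ IH]; simpl; intros n len.
  - replace (g * 1 * g^-1) with (1 : G) by group.
    exists []; repeat split; simpl; auto; lia.
  - destruct n as [|n]; [lia|].
    replace (g * (p * gprod ps) * g^-1)
      with ((g * p * g^-1) * (g * gprod ps * g^-1)) by group.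
    replace (S n + S n) with (2 + (n + n)) by lia.
    apply pal_len_mul; [now apply pal_len_conj_palindrome|apply IH; lia].
Qed.

(** The bound is uniform in [a]: the commutator is a conjugate of [b^-1], which costs [n + n], times
    [b], which costs [n]. *)
Lemma pal_len_comm a b n : pal_len_le X b n -> pal_len_le X (comm a b) (n + n + n).
Proof.
  intros len; replace (comm a b) with (a^-1 * b^-1 * (a^-1)^-1 * b) by group.
  apply pal_len_mul; auto; now apply pal_len_conj, pal_len_inv.
Qed.

Lemma pal_len_finite g : exists n, pal_len_le X g n.
Proof.
  induction (genX g) as [x Xx| |g h _ [n IHg] _ [k IHh]|g _ [n IH]].
  - exists 1%nat; now apply pal_len_palindrome, palindrome_gen.
  - exists 0; apply pal_len_one.
  - exists (n + k); now apply pal_len_mul.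
  - exists n; now apply pal_len_inv.
Qed.

End Palindromes.

(** * Subgroups and congruences *)

Arguments pal_len_mul {G X g h n k}.
Arguments pal_len_comm {G X}.
Arguments pal_len_finite {G X}.

Existing Class is_normal.

Section Subgroups.
Context {G : group}.
Implicit Types (x y z g : G) (H K N P U V : G -> Prop).

Definition full : G -> Prop := fun _ => True.
Definition trivial : G -> Prop := fun x => x = 1.

(** Equality in [G/K] for normal [K]; setoid rewriting with it stands in for computing in a quotient
    group. *)
Definition eqmod K x y : Prop := K (x^-1 * y).

(** Shaped so that [lcs N (S i)] is convertible to [commg (lcs N i) N]. *)
Definition commg H N : G -> Prop :=
  gen (fun z => exists a b, H a /\ N b /\ z = comm a b).

Lemma gen_subgroup (S : G -> Prop) : is_subgroup (gen S).
Proof. repeat split; [apply gen_one|apply gen_mul|apply gen_inv]. Qed.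

Lemma gen_min (S : G -> Prop) U :
  is_subgroup U -> (forall x, S x -> U x) -> forall x, gen S x -> U x.
Proof. intros (? & ? & ?) ?; induction 1; auto. Qed.

Lemma gen_normal (S : G -> Prop) :
  (forall x g, S x -> S (g^-1 * (x * g))) -> is_normal (gen S).
Proof.
  intros conj; split; [apply gen_subgroup|].
  intros x g Sx; induction Sx as [x Sx| |x y _ IHx _ IHy|x _ IH].
  - now apply gen_base, conj.
  - replace (g^-1 * (1 * g)) with (1 : G) by group; apply gen_one.
  - replace (g^-1 * (x * y * g)) with ((g^-1 * (x * g)) * (g^-1 * (y * g))) by group.
    now apply gen_mul.
  - replace (g^-1 * (x^-1 * g)) with (g^-1 * (x * g))^-1 by group.
    now apply gen_inv.
Qed.

#[export] Instance full_normal : is_normal full.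
Proof. now repeat split. Qed.

#[export] Instance trivial_normal : is_normal trivial.
Proof.
  repeat split; unfold trivial.
  - intros x y -> ->; group.
  - intros x ->; group.
  - intros x g ->; group.
Qed.

#[export] Instance commg_normal H N : is_normal H -> is_normal N -> is_normal (commg H N).
Proof.
  intros [_ conjH] [_ conjN]; apply gen_normal; intros z g (a & b & Ha & Nb & ->).
  exists (g^-1 * (a * g)), (g^-1 * (b * g)); repeat split; auto; group.
Qed.

#[export] Instance lcs_normal N i : is_normal N -> is_normal (lcs N i).
Proof. intros nN; induction i; [exact nN|exact (commg_normal _ _ _ _)]. Qed.

Lemma commg_comm H N a b : H a -> N b -> commg H N (comm a b).
Proof. intros Ha Nb; apply gen_base; eauto. Qed.

Lemma commg_subl H N x : is_normal H -> commg H N x -> H x.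
Proof.
  intros [sub conj]; apply gen_min; auto; intros z (a & b & Ha & _ & ->).
  now apply sub; [apply sub|apply conj].
Qed.

Lemma lcs_sub N i x : is_normal N -> lcs N i x -> N x.
Proof.
  intros nN; revert x; induction i as [|i IH]; auto.
  intros x Lx; apply IH; revert Lx; apply commg_subl; exact _.
Qed.

Lemma gen_mono (S S' : G -> Prop) x : (forall y, S y -> S' y) -> gen S x -> gen S' x.
Proof.
  intros sub; apply gen_min; [apply gen_subgroup|].
  intros; apply gen_base; auto.
Qed.

Lemma lcs_mono N N' i x : (forall y, N y -> N' y) -> lcs N i x -> lcs N' i x.
Proof.
  intros sub; revert x; induction i as [|i IH]; [exact sub|].
  intros x; change (commg (lcs N i) N x -> commg (lcs N' i) N' x).
  apply gen_mono; intros z (a & b & Ha & Hb & ->); exists a, b; auto.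
Qed.

#[export] Instance eqmod_equiv K : is_normal K -> Equivalence (eqmod K).
Proof.
  intros [(one & mul & inv) _]; unfold eqmod; split.
  - intros x; now rewrite gmulVg.
  - intros x y Kxy; apply inv in Kxy; now autorewrite with group in Kxy.
  - intros x y z Kxy Kyz; specialize (mul _ _ Kxy Kyz).
    now autorewrite with group in mul.
Qed.

#[export] Instance eqmod_mul K : is_normal K ->
  Proper (eqmod K ==> eqmod K ==> eqmod K) (gmul G).
Proof.
  intros [(one & mul & inv) conj] x x' Kx y y' Ky; unfold eqmod in *.
  replace ((x * y)^-1 * (x' * y'))
    with (y^-1 * ((x^-1 * x') * y) * (y^-1 * y')) by group.
  auto.
Qed.

#[export] Instance eqmod_inv K : is_normal K -> Proper (eqmod K ==> eqmod K) (ginv G).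
Proof.
  intros [(one & mul & inv) conj] x x' Kx; unfold eqmod in *.
  apply inv, (conj _ x^-1) in Kx.
  now autorewrite with group in Kx |- *.
Qed.

Lemma one_eqmod K x : K x -> eqmod K 1 x.
Proof. unfold eqmod; now rewrite inv1, gmul1g. Qed.

Lemma eqmod_one K x : eqmod K 1 x -> K x.
Proof. unfold eqmod; now rewrite inv1, gmul1g. Qed.

Lemma eqmod_commute K x y : K (comm x y) -> eqmod K (y * x) (x * y).
Proof. unfold eqmod, comm; now autorewrite with group. Qed.

Lemma subgroup_eqmod U K x y :
  is_subgroup U -> (forall z, K z -> U z) -> eqmod K x y -> U x -> U y.
Proof.
  intros (_ & mul & _) sub Kxy Ux; replace y with (x * (x^-1 * y)) by group; auto.
Qed.

End Subgroups.

(** * Bounded width modulo a normal subgroup *)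

Section Width.
Context {G : group} (X : list G) (genX : generates G X).
Implicit Types (x y z g : G) (H K N P U V : G -> Prop).

(** Finite palindromic width of the image of [H] in [G/K]; the approximant [g] need not lie in
    [H]. *)
Definition bounded H K : Prop :=
  exists n, forall h, H h -> exists g, pal_len_le X g n /\ eqmod K g h.

Lemma bounded_trans H K N : is_normal N ->
  bounded H K -> bounded K N -> bounded H N.
Proof.
  intros nN [n bd] [k bd']; exists (n + k); intros h Hh.
  destruct (bd h Hh) as (g & len & Kgh).
  destruct (bd' _ Kgh) as (g' & len' & Ng').
  exists (g * g'); split; [now apply pal_len_mul|].
  rewrite Ng'; replace (g * (g^-1 * h)) with h by group; reflexivity.
Qed.

Lemma bounded_sub H U K : (forall x, H x -> U x) -> bounded U K -> bounded H K.
Proof. intros sub [n bd]; exists n; auto. Qed.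

(** The set product of the [F b], in list order, times [K]. Ending in [K] rather than [1] makes it a
    union of cosets of [K]. *)
Fixpoint prodset {B : Type} (F : B -> G -> Prop) K (bs : list B) : G -> Prop :=
  match bs with
  | [] => K
  | b :: bs => fun z => exists u v, F b u /\ prodset F K bs v /\ z = u * v
  end.

Section CommutingProducts.
Context {B : Type} (F : B -> G -> Prop) K (nK : is_normal K).

Lemma prodset_bounded bs :
  (forall b, In b bs -> bounded (F b) K) -> bounded (prodset F K bs) K.
Proof.
  induction bs as [|b bs IH]; simpl; intros bd.
  - exists 0; intros h Kh; exists 1; split; [apply pal_len_one|].
    now apply one_eqmod.
  - destruct (bd b) as [n bdb]; auto; destruct IH as [k bdbs]; auto.
    exists (n + k); intros ? (u & v & Fu & Pv & ->).
    destruct (bdb u Fu) as (g & len & Kg), (bdbs v Pv) as (g' & len' & Kg').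
    exists (g * g'); split; [now apply pal_len_mul|now rewrite Kg, Kg'].
Qed.

Lemma prodset_commute u bs v :
  (forall b x, In b bs -> F b x -> eqmod K (u * x) (x * u)) ->
  prodset F K bs v -> eqmod K (u * v) (v * u).
Proof.
  revert v; induction bs as [|b bs IH]; simpl; intros v com.
  - intros Kv; rewrite <- (one_eqmod K v Kv).
    replace (u * 1) with (1 * u) by group; reflexivity.
  - intros (x & y & Fx & Py & ->).
    rewrite gmulA, (com b x), <- gmulA, IH, gmulA; eauto; reflexivity.
Qed.

(** Modulo [K] the factors are subgroups that commute elementwise, so factors of a product can be
    regrouped. The case [b = b'] says that each factor is itself abelian modulo [K]. *)
Lemma prodset_subgroup bs :
  (forall b, In b bs -> is_subgroup (F b)) ->
  (forall b x, In b bs -> K x -> F b x) ->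
  (forall b b' u v, In b bs -> In b' bs -> F b u -> F b' v ->
    eqmod K (u * v) (v * u)) ->
  is_subgroup (prodset F K bs) /\
  (forall x, K x -> prodset F K bs x) /\
  (forall b x, In b bs -> F b x -> prodset F K bs x).
Proof.
  induction bs as [|b bs IH]; simpl; intros subF KF comF.
  - destruct nK as [? _]; split; [|split]; tauto.
  - destruct IH as (sub & Ksub & Fsub); eauto.
    assert (com : forall u v, F b u -> prodset F K bs v -> eqmod K (u * v) (v * u)).
    { intros u v Fu; apply prodset_commute; intros c x bsc; eauto. }
    pose proof (subF b (or_introl eq_refl)) as (one & mul & inv).
    destruct sub as (one' & mul' & inv').
    (* Closure need only be checked modulo [K]: the discrepancy is absorbed by the tail of the
       product. *)
    assert (closed : forall u v z, F b u -> prodset F K bs v -> eqmod K (u * v) z ->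
      exists u v, F b u /\ prodset F K bs v /\ z = u * v).
    { intros u v z Fu Pv E; exists u, (v * ((u * v)^-1 * z)); split; auto; split.
      - apply mul'; [easy|exact (Ksub _ E)].
      - group. }
    repeat split.
    + exists 1, 1; repeat split; auto; group.
    + intros ? ? (u & v & Fu & Pv & ->) (u' & v' & Fu' & Pv' & ->).
      apply (closed (u * u') (v * v')); auto.
      rewrite <- (gmulA _ u), (gmulA _ u' v v'), (com u' v); auto.
      now rewrite !gmulA.
    + intros ? (u & v & Fu & Pv & ->); apply (closed u^-1 v^-1); auto.
      now rewrite <- invM, <- com by assumption.
    + intros x Kx; exists 1, x; repeat split; auto; group.
    + intros c x [<-|bsc] Fx.
      * exists x, 1; repeat split; auto; group.
      * exists 1, x; repeat split; eauto; group.
Qed.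

End CommutingProducts.

(* Under the commutation hypothesis each [a |-> [a, b]] is a homomorphism modulo
   [K] from [P] to a common abelian group; [T] is the product of the images. *)
Lemma comm_images_bounded P K bs : is_normal P -> is_normal K ->
  (forall a a' b, P a -> P a' -> In b bs -> K (comm (comm a b) a')) ->
  exists T, is_subgroup T /\ (forall x, K x -> T x) /\
    (forall a b, P a -> In b bs -> T (comm a b)) /\ bounded T K.
Proof.
  intros nP nK com.
  (* [F b] is the full preimage in [G] of the image of [a |-> [a, b]] modulo [K]. *)
  set (F b z := exists a, P a /\ eqmod K (comm a b) z).
  destruct nP as [(one & mul & inv) conj].
  assert (Pcomm : forall a b, P a -> P (comm a b)) by (intros; apply mul; auto).
  assert (subF : forall b, In b bs -> is_subgroup (F b)).
  { intros b bsb; repeat split.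
    - exists 1; split; auto; replace (comm 1 b) with (1 : G) by group; reflexivity.
    - intros z z' (a & Pa & Ez) (a' & Pa' & Ez'); exists (a * a'); split; auto.
      (* This is [[a a', b] = [a, b]^a' [a', b]]; [com] then removes the conjugation by [a']. *)
      replace (comm (a * a') b) with (a'^-1 * (comm a b * a') * comm a' b) by group.
      rewrite <- (eqmod_commute _ _ _ (com _ _ _ Pa Pa' bsb)).
      replace (a'^-1 * (a' * comm a b)) with (comm a b) by group.
      now rewrite Ez, Ez'.
    - intros z (a & Pa & Ez); exists a^-1; split; auto.
      rewrite <- Ez.
      replace (comm a^-1 b) with (a * (a * comm a b)^-1) by group.
      rewrite (eqmod_commute _ _ _ (com _ _ _ Pa Pa bsb)).
      replace (a * (comm a b * a)^-1) with (comm a b)^-1 by group.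
      reflexivity. }
  assert (KF : forall b x, In b bs -> K x -> F b x).
  { intros b x _ Kx; exists 1; split; auto.
    replace (comm 1 b) with (1 : G) by group; now apply one_eqmod. }
  assert (comF : forall b b' u v, In b bs -> In b' bs -> F b u -> F b' v ->
    eqmod K (u * v) (v * u)).
  (* [com] applies because the second commutator again lies in [P]. *)
  { intros b b' u v bsb bsb' (a & Pa & <-) (a' & Pa' & <-).
    symmetry; apply eqmod_commute; auto. }
  destruct (prodset_subgroup F K nK bs subF KF comF) as (sub & Ksub & Fsub).
  exists (prodset F K bs); repeat split; try apply sub; auto.
  - intros a b Pa bsb; apply (Fsub b); auto.
    exists a; split; auto; reflexivity.
  - apply prodset_bounded; auto; intros b _.
    destruct (pal_len_finite genX b) as [n len]; exists (n + n + n).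
    intros h (a & _ & E); exists (comm a b); split; auto; now apply pal_len_comm.
Qed.

Lemma abelianization_bounded : bounded full (commg full full).
Proof.
  set (K := commg full full).
  assert (nK : is_normal K) by exact _.
  assert (com : forall x y, eqmod K (x * y) (y * x))
    by now intros; apply eqmod_commute, commg_comm.
  (* [pow] takes natural exponents, so an integer power is a quotient of two powers, at a cost of
     two palindromes per generator. *)
  set (F x z := exists i j, eqmod K (pow _ x i * (pow _ x j)^-1) z).
  assert (subF : forall x, is_subgroup (F x)).
  { intros x; repeat split.
    - exists 0%nat, 0%nat; cbn [pow].
      replace (1 * 1^-1) with (1 : G) by group; reflexivity.
    - intros z z' (i & j & E) (i' & j' & E'); exists (i + i'), (j + j').
      rewrite <- E, <- E', 2!pow_add.
      generalize (pow _ x i), (pow _ x j), (pow _ x i'), (pow _ x j').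
      intros p q r s; replace (p * r * (q * s)^-1) with (p * (r * s^-1 * q^-1)) by group.
      rewrite (com (r * s^-1)), gmulA; reflexivity.
    - intros z (i & j & E); exists j, i; rewrite <- E, invM, invK; reflexivity. }
  assert (KF : forall x z, K z -> F x z).
  { intros x z Kz; exists 0, 0; cbn [pow]; replace (1 * 1^-1) with (1 : G) by group.
    now apply one_eqmod. }
  destruct (prodset_subgroup F K nK X) as (sub & _ & Fsub); auto.
  apply bounded_sub with (prodset F K X).
  - intros g _; generalize (genX g); apply gen_min; auto; intros x Xx.
    apply (Fsub x); auto; exists 1%nat, 0%nat; simpl.
    replace (x * 1 * 1^-1) with x by group; reflexivity.
  - apply prodset_bounded; auto; intros x Xx; exists 2; intros h (i & j & E).
    exists (pow _ x i * (pow _ x j)^-1); split; auto.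
    apply (pal_len_mul (n := 1) (k := 1)); apply pal_len_palindrome.
    + now apply palindrome_pow.
    + now apply palindrome_inv, palindrome_pow.
Qed.

(** The subgroup [T] built from [[a, x]], [x] in [X], contains every [[a, g]]: the identity
    [[a, g h] = [a, g] [a^g, h]] allows induction on [g], with [a] varying within the normal
    subgroup [H]. *)
Lemma comm_full_bounded H K : is_normal H -> is_normal K ->
  (forall a a' g, H a -> H a' -> K (comm (comm a g) a')) ->
  bounded (commg H full) K.
Proof.
  intros nH nK com.
  destruct (comm_images_bounded H K X) as (T & sub & _ & Tcomm & bd); auto.
  revert bd; apply bounded_sub, gen_min; auto.
  intros z (a & g & Ha & _ & ->); revert a Ha.
  destruct nH as [_ conj], sub as (one & mul & inv).
  induction (genX g) as [x Xx| |g h _ IHg _ IHh|g _ IH]; intros a Ha; auto.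
  - replace (comm a 1) with (1 : G) by group; auto.
  - replace (comm a (g * h)) with (comm a g * comm (g^-1 * (a * g)) h) by group.
    auto.
  - replace (comm a g^-1) with (comm (g^-1^-1 * (a * g^-1)) g)^-1 by group.
    auto.
Qed.

(** * Normal closures and simple commutators *)

Definition normal_closure (S : list G) : G -> Prop :=
  gen (fun z => exists s g, In s S /\ z = g^-1 * (s * g)).

#[local] Instance normal_closure_normal S : is_normal (normal_closure S).
Proof.
  apply gen_normal; intros z h (s & g & Ss & ->); exists s, (g * h); split; auto.
  group.
Qed.

Lemma normal_closure_base S s : In s S -> normal_closure S s.
Proof. intros Ss; apply gen_base; exists s, 1; split; auto; group. Qed.

(** As [commg P N] is central modulo [K], [b |-> [a, b]] is multiplicative modulo [K], and a
    conjugation of [b] can be moved onto [a]. So the commutators with the listed elements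
    suffice. *)
Lemma comm_normal_closure_bounded P N K bs :
  is_normal P -> is_normal N -> is_normal K ->
  (forall b, In b bs -> N b) -> (forall x, N x -> normal_closure bs x) ->
  (forall z g, commg P N z -> K (comm z g)) ->
  bounded (commg P N) K.
Proof.
  intros nP nN nK bsN Nbs com.
  destruct (comm_images_bounded P K bs) as (T & sub & KT & Tcomm & bd); auto.
  { intros a a' b Pa _ bsb; apply com, commg_comm; auto. }
  assert (Teq : forall x y, eqmod K x y -> T x -> T y)
    by (intros x y; now apply subgroup_eqmod).
  assert (conjK : forall a b g, P a -> N b ->
    eqmod K (comm a b) (g^-1 * (comm a b * g))).
  { intros a b g Pa Nb.
    rewrite <- (eqmod_commute _ _ _ (com _ g (commg_comm _ _ _ _ Pa Nb))).
    replace (g^-1 * (g * comm a b)) with (comm a b) by group; reflexivity. }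
  revert bd; apply bounded_sub, gen_min; auto.
  intros z (a & b & Pa & Nb & ->); apply Nbs in Nb; revert a Pa.
  destruct nP as [_ conjP], nN as [(one & mul & inv) conjN].
  destruct sub as (oneT & mulT & invT).
  (* [N b] is carried through the induction because [conjK] needs it for each intermediate
     element. *)
  enough (N b /\ forall a, P a -> T (comm a b)) by tauto.
  induction Nb as [c (s & g & Ss & ->)| |b c _ [Nb IHb] _ [Nc IHc]|b _ [Nb IH]];
    split; auto; intros a Pa.
  - apply (Teq (comm (g^-1^-1 * (a * g^-1)) s)); auto.
    rewrite (conjK _ _ g) by auto.
    replace (g^-1 * (comm (g^-1^-1 * (a * g^-1)) s * g))
      with (comm a (g^-1 * (s * g))) by group; reflexivity.
  - replace (comm a 1) with (1 : G) by group; auto.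
  - apply (Teq (comm a c * comm a b)); auto.
    rewrite (conjK a b c) by auto.
    replace (comm a c * (c^-1 * (comm a b * c))) with (comm a (b * c)) by group.
    reflexivity.
  - apply (Teq (comm a b)^-1); auto.
    rewrite (conjK a b b^-1) by auto.
    replace (b^-1^-1 * (comm a b * b^-1))^-1 with (comm a b^-1) by group.
    reflexivity.
Qed.

(** Left-normed commutators of [k + 1] generators, the shift matching that of [lcs]. *)
Fixpoint simple_comms (k : nat) : list G :=
  match k with
  | 0 => X
  | S k => flat_map (fun s => map (comm s) X) (simple_comms k)
  end.

Lemma simple_comms_lcs k s : In s (simple_comms k) -> lcs full k s.
Proof.
  revert s; induction k as [|k IH]; intros s; [easy|].
  intros ins; apply in_flat_map in ins as (t & int & ins).
  apply in_map_iff in ins as (x & <- & _).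
  exact (commg_comm _ _ _ _ (IH t int) I).
Qed.

(** Modulo [R], simple commutators of the previous weight commute with each generator, hence with
    all of [G]. So their normal closure, which contains [lcs full k] by induction, is central modulo
    [R], and its commutators with [G] fall into [R]. *)
Lemma lcs_normal_closure k g : lcs full k g -> normal_closure (simple_comms k) g.
Proof.
  revert g; induction k as [|k IH]; intros g.
  { intros _; generalize (genX g); apply gen_min; [apply gen_subgroup|].
    apply normal_closure_base. }
  set (R := normal_closure (simple_comms (S k))).
  assert (nR : is_normal R) by exact _.
  assert (central : forall s, In s (simple_comms k) ->
    forall g, eqmod R (s * g) (g * s)).
  { intros s ins h; induction (genX h) as [x Xx| |h h' _ IHh _ IHh'|h _ IHh].
    - symmetry; apply eqmod_commute, normal_closure_base, in_flat_map.
      exists s; split; auto; now apply in_map.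
    - replace (s * 1) with (1 * s) by group; reflexivity.
    - now rewrite gmulA, IHh, <- gmulA, IHh', gmulA.
    - replace (s * h^-1) with (h^-1 * (h * s) * h^-1) by group.
      rewrite <- IHh; replace (h^-1 * (s * h) * h^-1) with (h^-1 * s) by group.
      reflexivity. }
  apply gen_min; [apply nR|]; intros z (a & h & La & _ & ->).
  enough (E : forall h, eqmod R (a * h) (h * a)).
  { apply eqmod_one; unfold comm; rewrite E.
    replace (a^-1 * (h^-1 * (h * a))) with (1 : G) by group; reflexivity. }
  apply IH in La; clear h.
  induction La as [z (s & g' & ins & ->)| |b c _ IHb _ IHc|b _ IHb];
    intros h.
  - rewrite (central s ins g').
    replace (g'^-1 * (g' * s)) with s by group; auto.
  - replace (1 * h) with (h * 1) by group; reflexivity.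
  - rewrite <- gmulA, (IHc h), gmulA, (IHb h), gmulA; reflexivity.
  - replace (b^-1 * h) with (b^-1 * (h * b) * b^-1) by group.
    rewrite <- IHb; replace (b^-1 * (b * h) * b^-1) with (h * b^-1) by group.
    reflexivity.
Qed.

(** * Bounded width along the chain of subgroups *)

Lemma lcs_full_bounded k : bounded full (lcs full (S k)).
Proof.
  induction k as [|k IH]; [apply abelianization_bounded|].
  apply (bounded_trans _ _ _ (lcs_normal _ (S (S k)) full_normal) IH).
  apply (comm_full_bounded (lcs full k)); try exact _.
  intros a a' g La _; apply commg_comm; [now apply commg_comm|easy].
Qed.

Lemma lcs_lcs_bounded d c :
  bounded full (commg (lcs (lcs full d) c) full).
Proof.
  set (N := lcs full d).
  assert (nN : is_normal N) by exact _.
  (* For [c = 0] the target [[N, G]] is [lcs full (S d)] by conversion. *)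
  induction c as [|c IH]; [apply lcs_full_bounded|].
  refine (bounded_trans _ _ _ _ IH (bounded_trans _ (lcs N (S c)) _ _ _ _));
    try exact _.
  (* From [[N_c, G]] down to [N_{c+1}]: [[a, g]] stays in [N_c] and [a'] lies in [N], so their
     commutator is in [N_{c+1}]. *)
  - apply comm_full_bounded; try exact _.
    intros a a' g La La'; apply commg_comm; [|now apply lcs_sub in La'].
    apply (commg_subl _ full); [exact _|now apply commg_comm].
  (* From [N_{c+1}] down to [[N_{c+1}, G]], modulo which it is central. *)
  - apply (comm_normal_closure_bounded _ _ _ (simple_comms d)); try exact _.
    + intros b; apply simple_comms_lcs.
    + intros x; apply lcs_normal_closure.
    + intros z g Lz; now apply commg_comm.
Qed.

End Width.

Theorem theorem1p2 (G : group) :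
  in_UNN G ->
  forall X : list G, generates G X -> pw_finite G X.
Proof.
  intros (A & N & _ & _ & _ & abA & [c nilN] & [d nilG]) X genX.
  (* [lcs full d] lies in [N] and replaces it, since it has finitely many known normal generators;
     [L] then lies in [lcs N c], hence in [A]. *)
  set (L := lcs (lcs (@full G) d) c).
  assert (LA : forall x, L x -> A x).
  { intros x Lx; apply nilN; revert Lx; now apply lcs_mono. }
  assert (nL : is_normal L) by exact _.
  assert (bd : bounded X full trivial).
  { apply (bounded_trans _ _ (commg L full)); [exact _|now apply lcs_lcs_bounded|].
    apply comm_full_bounded; try exact _; auto.
    (* Last link, from [[L, G]] to [1]: [[a, g]] and [a'] both lie in the abelian [A]. *)
    intros a a' g La La'; unfold trivial, comm at 1.
    rewrite (abA (comm a g) a'); auto; [group|].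
    apply LA, (commg_subl _ full); [exact _|now apply commg_comm]. }
  destruct bd as [n bd]; exists n; intros h; destruct (bd h I) as (g & len & E).
  unfold eqmod, trivial in E.
  replace h with (g * (g^-1 * h)) by group; now rewrite E, mulg1.
Qed.
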